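(* Let $G^+$ be a Garside monoid, with Garside element $\Delta$. Then: (a) every Garside submonoid of $G^+$ has a Garside monoid structure; (b) every element of a Garside submonoid has the same normal form considered as an element of $G^+$ or considered as an element of the submonoid; (c) the intersection of two Garside submonoids of $G^+$ is a Garside submonoid of $G^+$.
   Context: Divisibility. In a monoid $M$, $g$ left-divides $h$ (written $g\prec h$) if $h=gk$ for some $k\in M$, and $g$ right-divides $h$ (written $h\succ g$) if $h=kg$ for some $k\in M$. $L(h)$ and $R(h)$ denote the sets of left-divisors and right-divisors of $h$. $M$ is cancellative if $ghk=gh'k$ implies $h=h'$; $M$ is Noetherian if for every $g\in M$ the set $\{k\in\mathbb N\mid g=g_1\cdots g_k,\ g_i\in M,\ g_i\neq 1\}$ is finite. $\Delta\in M$ is balanced if $L(\Delta)=R(\Delta)$; this common set is then denoted $D(\Delta)$. Garside monoids. A pair $(G^+,X)$, with $G^+$ a monoid and $X\subset G^+$, is a positive Garside system if: $G^+$ is Noetherian and cancellative; $G^+$ is a lattice for left-divisibility and a lattice for right-divisibility; $X$ generates $G^+$ and $X=D(\Delta)$ for some balanced $\Delta\in G^+$. Then $\Delta$ is called the Garside element, and $G^+$ is called a Garside monoid when $D(\Delta)$ is finite. The g.c.d. and l.c.m. of $g,h$ in $G^+$ are denoted $g\land_L h$, $g\lor_L h$ for $\prec$ and $g\land_R h$, $g\lor_R h$ for $\succ$. Normal form. Put $\alpha_L(w)=w\land_L\Delta$ (the greatest element of $D(\Delta)$, for left-divisibility, that left-divides $w$) and $\alpha_R(w)=w\land_R\Delta$.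 The (left) normal form of $w\in G^+\setminus\{1\}$ is the sequence $(w_1,\dots,w_n)$ defined by $w=w_1\cdots w_n$, $w_n\neq1$ and $\alpha_L(w_i\cdots w_n)=w_i$ for every $i$. Garside submonoids. A sublattice of a lattice is a non-empty subset closed under $\land$ and $\lor$. A submonoid $H^+$ of $G^+$ is a Garside submonoid of $G^+$ if (1) $H^+$ is a sublattice of $G^+$ for left-divisibility and for right-divisibility, i.e. it is closed under $\land_L,\lor_L$ and under $\land_R,\lor_R$ computed in $G^+$; and (2) $\alpha_L(H^+)\subset H^+$ and $\alpha_R(H^+)\subset H^+$. The Garside monoid structure considered on a Garside submonoid $H^+$ is the pair $(H^+,H^+\cap D(\Delta))$, whose Garside element is the upper bound of $H^+\cap D(\Delta)$; the normal form of an element considered as an element of $H^+$ is the one relative to this structure.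
   Formalization: ''Sublattice'' also requires that left- and right-divisibility in H+ (cofactor in H+) agree with those of G+ on H+; with closure under the four operations alone, (a) and (b) fail for G+ = N, Δ = 2, H+ = N minus {1}. In (c) this is both assumed and proved. *)

(* Defs.v *)
From HB Require Import structures.
From mathcomp Require Import all_boot.
From mathcomp Require Import boolp classical_sets cardinality.

Set Implicit Arguments.
Unset Strict Implicit.
Unset Printing Implicit Defensive.

Local Open Scope classical_set_scope.
Local Open Scope group_scope.

(* Orders given as bare Prop-valued relations: a monoid carries two of them. *)
Section Lattices.
Variables (T : choiceType) (le : T -> T -> Prop).

Definition is_glb (x y m : T) : Prop :=
  [/\ le m x, le m y & forall z, le z x -> le z y -> le z m].

Definition is_lub (x y j : T) : Prop :=
  [/\ le x j, le y j & forall z, le x z -> le y z -> le j z].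

Definition is_sup (A : set T) (j : T) : Prop :=
  (forall x, A x -> le x j) /\
  (forall z, (forall x, A x -> le x z) -> le j z).

Definition is_lattice : Prop :=
  [/\ forall x, le x x,
      forall x y, le x y -> le y x -> x = y,
      forall x y z, le x y -> le y z -> le x z,
      forall x y, exists m, is_glb x y m &
      forall x y, exists j, is_lub x y j].

(* The default x0 is returned only when no greatest lower (least upper) bound
   exists, hence never in a lattice. *)
Definition meet (x0 x y : T) : T := xget x0 [set m | is_glb x y m].
Definition join (x0 x y : T) : T := xget x0 [set j | is_lub x y j].

(* leA is the order carried by A. *)
Definition sublattice (x0 : T) (A : set T) (leA : T -> T -> Prop) : Prop :=
  [/\ A !=set0,
      forall x y, A x -> A y -> A (meet x0 x y),
      forall x y, A x -> A y -> A (join x0 x y) &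
      forall x y, A x -> A y -> (leA x y <-> le x y)].

End Lattices.

Section Divisibility.
Variable M : monoidType.
Implicit Types (g h k D w : M) (X H : set M).

Definition ldvd g h : Prop := exists k, h = g * k.
(* rdvd g h : g right-divides h *)
Definition rdvd g h : Prop := exists k, h = k * g.

Definition ldivisors h : set M := [set g | ldvd g h].
Definition rdivisors h : set M := [set g | rdvd g h].

Definition cancellative : Prop :=
  forall g h h' k, g * h * k = g * h' * k -> h = h'.

Definition noetherian : Prop := forall g,
  finite_set [set n : nat | exists s : seq M,
    [/\ size s = n, forall x, x \in s -> x <> 1 & g = \prod_(x <- s) x]].

Definition balanced D : Prop := ldivisors D = rdivisors D.

Definition generates X : Prop :=
  smallest (fun H => monoid_closed [in H]) X = [set: M].

Definition garside_element X D : Prop := balanced D /\ X = ldivisors D.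

Definition positive_garside_system X : Prop :=
  [/\ noetherian /\ cancellative,
      is_lattice ldvd,
      is_lattice rdvd,
      generates X &
      exists D, garside_element X D].

Definition garside_monoid X : Prop :=
  positive_garside_system X /\ finite_set X.

Definition lgcd g h : M := meet ldvd 1 g h.
Definition rgcd g h : M := meet rdvd 1 g h.

Definition alphaL D w : M := lgcd w D.
Definition alphaR D w : M := rgcd w D.

(* Indices start at 0, so drop i s is the sequence of the factors of s of index
   at least i. With the default value 1 of last, the empty sequence is not a
   normal form. *)
Definition normal_form D w (s : seq M) : Prop :=
  [/\ w = \prod_(x <- s) x,
      last 1 s <> 1 &
      forall i, (i < size s)%N -> alphaL D (\prod_(x <- drop i s) x) = s`_i].

(* Left- and right-divisibility of the submonoid H: the cofactor lies in H. *)
Definition ldvd_in H g h : Prop := exists2 k, H k & h = g * k.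
Definition rdvd_in H g h : Prop := exists2 k, H k & h = k * g.

(* (H, ldvd_in H) is a sublattice of (M, ldvd), and not just H as a subset with
   the order induced by ldvd: gcds and lcms in H are then those of M. Closure
   of H under the lattice operations of M does not imply it: in the additive
   monoid nat with Garside element 2, the submonoid H = nat minus 1 is closed
   under min, max and n |-> min n 2, but 2 and 3 have no lcm in H. *)
Record garside_submonoid D H : Prop := GarsideSubmonoid {
  garside_submonoid_closed : monoid_closed [in H];
  garside_submonoid_ldvd : sublattice ldvd 1 H (ldvd_in H);
  garside_submonoid_rdvd : sublattice rdvd 1 H (rdvd_in H);
  garside_submonoid_alphaL : alphaL D @` H `<=` H;
  garside_submonoid_alphaR : alphaR D @` H `<=` H
}.

End Divisibility.

Definition submonoid_type (M : monoidType) (H : set M)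
  (closedH : monoid_closed [in H]) : Type := {x : M | x \in H}.

Section SubmonoidInstances.
Variables (M : monoidType) (H : set M) (closedH : monoid_closed [in H]).

HB.instance Definition _ := SubChoice.on (submonoid_type closedH).
HB.instance Definition _ := SubChoice_isSubMonoid.Build M [in H]
  (submonoid_type closedH) closedH.

End SubmonoidInstances.

(* Main.v *)
Require Import Defs.
From HB Require Import structures.
From mathcomp Require Import all_boot.
From mathcomp Require Import boolp classical_sets cardinality.

Set Implicit Arguments.
Unset Strict Implicit.
Unset Printing Implicit Defensive.

Local Open Scope classical_set_scope.
Local Open Scope group_scope.

(** The submonoid [H] inherits the structure of [G] through the inclusion [val].
Being a sublattice makes divisibility in [H] the restriction of divisibility
in [G], so gcds and lcms in [H] are those of [G]; noetherianity and cancellation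
restrict to any submonoid. Since [H] is closed under [alphaL D], the head of the
normal form of an element of [H] is in [H], and so is the cofactor, as
divisibility is restricted; iterating, [H] is generated by its simple elements,
[H `&` ldivisors D] ([submonoid_generates]).

The remaining point of (a) is a balanced Garside element
([submonoid_garside_element]). The finite set [H `&` ldivisors D] is closed
under both lcms, hence has a greatest element for each of the two
divisibilities. These two elements coincide: each divides the other, on opposite
sides, and a superadditive length function, which exists in any noetherian
monoid ([noetherian_length]), forbids proper factors in such a situation.

For (b), the gcd with the Garside element of [H] and the gcd with [D] agree on
[H] ([val_alphaL]), so [val] maps normal forms in [H] to normal forms in [G];
existence in [H] and uniqueness in both monoids come from the general theory of
normal forms. For (c), cofactors are unique by cancellation, hence belong to
an intersection as soon as they belong to both submonoids. *)

(** * Lattices given by a bare order relation *)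

Section LatticeFacts.
Variables (T : choiceType) (le : T -> T -> Prop).
Hypothesis latT : is_lattice le.

Lemma meetP x0 x y : is_glb le x y (meet le x0 x y).
Proof. by have [_ _ _ glb _] := latT; apply: xgetPex (glb x y). Qed.

Lemma joinP x0 x y : is_lub le x y (join le x0 x y).
Proof. by have [_ _ _ _ lub] := latT; apply: xgetPex (lub x y). Qed.

Lemma glb_unique x y m m' : is_glb le x y m -> is_glb le x y m' -> m = m'.
Proof.
have [_ anti _ _ _] := latT.
by move=> [mx my gm] [mx' my' gm']; apply: anti; [apply: gm' | apply: gm].
Qed.

(** The order of the sublattice may be a smaller relation than [le], as
divisibility with a cofactor in the submonoid is; it only has to agree with
[le] on [A]. The injection [f] lets the sublattice be a type of its own. *)
Lemma sublattice_is_lattice x0 (A : set T) (leA : T -> T -> Prop)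
    (S : choiceType) (leS : S -> S -> Prop) (f : S -> T) :
    sublattice le x0 A leA -> injective f -> range f = A ->
    (forall x y, leS x y <-> leA (f x) (f y)) ->
  is_lattice leS.
Proof.
move=> [_ meetA joinA leAE] f_inj defA leSE; subst A.
have [refl anti trans _ _] := latT.
have leE x y : leS x y <-> le (f x) (f y).
  by rewrite leSE leAE.
split=> [x|x y /leE xy /leE yx|x y z /leE xy /leE yz|x y|x y].
- exact/leE.
- exact/f_inj/anti.
- exact/leE/(trans _ (f y)).
- have [//|//|m _ fm] := meetA (f x) (f y).
  have [mx my gm] := meetP x0 (f x) (f y); exists m.
  rewrite -fm in mx my gm; split; [exact/leE | exact/leE |].
  by move=> z /leE zx /leE zy; apply/leE/gm.
- have [//|//|j _ fj] := joinA (f x) (f y).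
  have [xj yj lj] := joinP x0 (f x) (f y); exists j.
  rewrite -fj in xj yj lj; split; [exact/leE | exact/leE |].
  by move=> z /leE xz /leE yz; apply/leE/lj.
Qed.

End LatticeFacts.

Lemma finite_directed_max (T : choiceType) (le : T -> T -> Prop) (A : set T) :
    (forall x, le x x) -> (forall x y z, le x y -> le y z -> le x z) ->
    finite_set A -> A !=set0 ->
    (forall x y, A x -> A y -> exists j, [/\ A j, le x j & le y j]) ->
  exists2 m, A m & forall x, A x -> le x m.
Proof.
move=> refl trans /finite_seqP[s defA] [a Aa] dirA.
suff [m Am ms] : exists2 m, A m & forall x, x \in s -> le x m.
  by exists m => // x; rewrite defA; apply: ms.
have {defA}: {subset s <= A} by move=> x xs; rewrite inE defA.
elim: s => [_|x s IHs sA]; first by exists a.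
have [y|m Am ms] := IHs; first by move=> ys; rewrite sA// inE ys orbT.
have [|j [Aj xj mj]] := dirA x m _ Am; first by rewrite -inE sA// mem_head.
exists j => // y; rewrite inE => /predU1P[->//|ys].
exact: trans (ms _ ys) mj.
Qed.

(** * Length functions *)

(** The length plays the part of a degree: proper factors are shorter, so it
supports inductions on divisibility. *)
Definition length_function (M : monoidType) (l : M -> nat) : Prop :=
  (forall g h, (l g + l h <= l (g * h)%g)%N) /\ (forall g, l g = 0%N -> g = 1).

Lemma length_ltM (M : monoidType) (l : M -> nat) g h :
  length_function l -> g <> 1 -> (l h < l (g * h)%g)%N.
Proof.
move=> [l_mul l0] g1; apply: leq_trans (l_mul g h).
by rewrite -[X in (X < _)%N]add0n ltn_add2r lt0n; apply/eqP => /l0.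
Qed.

(** The greatest number of nontrivial factors in a decomposition of an element
is a length, since decompositions can be concatenated. *)
Lemma noetherian_length (M : monoidType) :
  noetherian M -> exists l : M -> nat, length_function l.
Proof.
move=> noeM; pose dec (g : M) (s : seq M) :=
  (forall x, x \in s -> x <> 1) /\ g = \prod_(x <- s) x.
have dec1 g : g <> 1 -> dec g [:: g].
  by move=> g1; split=> [x|]; rewrite ?big_seq1// inE => /eqP->.
have [g|l lP] := @choice M nat (fun g n =>
    (exists2 s, dec g s & size s = n) /\
    forall s, dec g s -> (size s <= n)%N).
  have [|||n [s [sn s1 gs]] ubn] :=
      @finite_directed_max _ (fun m n : nat => (m <= n)%N : Prop) _
        (fun m => leqnn m) _ (noeM g).
  - by move=> m n p; apply: leq_trans.
  - have [->|g1] := pselect (g = 1).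
      by exists 0%N, [::]; split=> //; rewrite big_nil.
    by have [? ?] := dec1 g g1; exists 1%N, [:: g].
  - move=> m n Am An; exists (maxn m n).
    by rewrite leq_maxl leq_maxr; split=> //; case: leqP.
  - exists n; split; first by exists s.
    by move=> t [t1 gt]; apply: ubn; exists t.
exists l; split=> [g h|g lg0].
  have [[s [s1 ->] <-] _] := lP g; have [[t [t1 ->] <-] _] := lP h.
  rewrite -big_cat -size_cat; have [_] := lP (\prod_(x <- s ++ t) x); apply.
  by split=> // x; rewrite mem_cat => /orP[/s1|/t1].
have [//|/dec1 /(proj2 (lP g))] := pselect (g = 1).
by rewrite lg0.
Qed.

(** * Cancellation and divisibility *)

Lemma cancellative_mulgI (M : monoidType) : cancellative M ->
  right_injective (@mul M).
Proof. by move=> canM g h h' E; apply: (canM g _ _ 1); rewrite !mulg1. Qed.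

Lemma cancellative_mulIg (M : monoidType) : cancellative M ->
  left_injective (@mul M).
Proof. by move=> canM g h h' E; apply: (canM 1 _ _ g); rewrite !mul1g. Qed.

(** A divisor of 1 is divided by 1, so antisymmetry excludes units. *)
Lemma mulg_eq1r (M : monoidType) (g h : M) :
  is_lattice (@ldvd M) -> g * h = 1 -> h = 1.
Proof.
move=> [_ anti _ _ _] gh1; have g1 : g = 1.
  by apply: anti; [exists h | exists g; rewrite mul1g].
by rewrite -gh1 g1 mul1g.
Qed.

(** * Normal forms *)

Section NormalForm.
Variables (M : monoidType) (D : M).
Hypothesis latM : is_lattice (@ldvd M).

Lemma alphaLP w : is_glb (@ldvd M) w D (alphaL D w).
Proof. exact: meetP. Qed.

(** The elements that are 1 or have a nontrivial divisor in [ldivisors D] form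
a submonoid containing [ldivisors D]; by generation it is everything. *)
Lemma alphaL_neq1 w : generates (ldivisors D) -> w <> 1 -> alphaL D w <> 1.
Proof.
move=> genD w1 aw1; have [refl anti _ _ _] := latM.
pose P := [set v : M | v = 1 \/ exists x, [/\ ldvd x D, x <> 1 & ldvd x v]].
have PT : [set: M] `<=` P.
  rewrite -genD; apply: smallest_sub => [|x xD].
    split=> [|u v]; rewrite !inE; first by left.
    move=> [->|[x [xD x1 [k ->]]]]; first by rewrite mul1g.
    by move=> _; right; exists x; split=> //; exists (k * v); rewrite mulgA.
  by have [->|x1] := pselect (x = 1); [left | right; exists x].
have [//|[x [xD x1 xw]]] := PT w I; apply: x1; apply: anti.
  by have [_ _] := alphaLP w; rewrite aw1; apply.
by exists x; rewrite mul1g.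
Qed.

Lemma normal_form_cons w x s : normal_form D w (x :: s) <->
  [/\ w = x * \prod_(y <- s) y, alphaL D w = x &
      if s is [::] then x <> 1 else normal_form D (\prod_(y <- s) y) s].
Proof.
split=> [[-> x1 aE]|[-> ax nf_s]].
  rewrite big_cons; split=> //.
    by have := aE 0%N isT; rewrite drop0 big_cons.
  by case: s x1 aE => // y s x1 aE; split=> // i i_s; apply: (aE i.+1).
split; first by rewrite big_cons.
  by case: s nf_s {ax} => // y s [].
case=> [_|i i_s]; first by rewrite drop0 big_cons.
by case: s i_s nf_s {ax} => // y s i_s [_ _ aE]; apply: (aE i).
Qed.

(** The last factor of a normal form is not 1, and there are no units. *)
Lemma normal_form_neq1 w s : normal_form D w s -> w <> 1.
Proof.
case/lastP: s => [[]//|s x] [-> + _]; rewrite last_rcons => x1.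
by rewrite -cats1 big_cat big_seq1 => /(mulg_eq1r latM).
Qed.

Lemma normal_form_inj w s t :
  cancellative M -> normal_form D w s -> normal_form D w t -> s = t.
Proof.
move=> canM; elim: s w t => [|x s IHs] w [|y t]; try by [case | move=> _ []].
move=> /normal_form_cons[wE ax nf_s] /normal_form_cons[wE' ay nf_t].
subst x y; congr (_ :: _).
have st := cancellative_mulgI canM (etrans (esym wE) wE').
case: s t st nf_s nf_t IHs {wE wE'} => [|x' s] [|y' t] st // nf_s nf_t IHs.
- by case: (normal_form_neq1 nf_t); rewrite -st big_nil.
- by case: (normal_form_neq1 nf_s); rewrite st big_nil.
- by apply: IHs nf_s _; rewrite st.
Qed.

(** The greedy algorithm terminates because the head [alphaL D w] is nontrivial,
so that its cofactor is shorter than [w]. *)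
Lemma normal_form_exists w : noetherian M -> generates (ldivisors D) ->
  w <> 1 -> exists s, normal_form D w s.
Proof.
move=> /noetherian_length[l l_len] genD.
have [n] := ubnP (l w); elim: n => // n IHn in w *; rewrite ltnS => lwn w1.
have [[k wE] _ _] := alphaLP w.
have aw1 := alphaL_neq1 genD w1.
have [k1|k1] := pselect (k = 1).
  exists [:: alphaL D w]; apply/normal_form_cons; split=> //.
  by rewrite big_nil -k1.
have [|s nf_s] := IHn k _ k1; last first.
  have kE : k = \prod_(x <- s) x by case: nf_s.
  exists (alphaL D w :: s); apply/normal_form_cons; rewrite -kE; split=> //.
  by case: s nf_s {kE} => // -[].
by apply: leq_trans lwn; rewrite wE; apply: length_ltM.
Qed.

End NormalForm.

(** * Garside submonoids *)

Section GarsideSubmonoid.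
Variables (G : monoidType) (X : set G) (D : G).
Hypotheses (garsideG : garside_monoid X) (garsideD : garside_element X D).
Variables (H : set G) (subH : garside_submonoid D H).

Local Notation M := (submonoid_type (garside_submonoid_closed subH)).
Local Notation XH := ([set x | ldivisors D (val x)] : set M).

Let noeG : noetherian G. Proof. by have [[[]]] := garsideG. Qed.
Let canG : cancellative G. Proof. by have [[[]]] := garsideG. Qed.
Let latL : is_lattice (@ldvd G). Proof. by have [[]] := garsideG. Qed.
Let latR : is_lattice (@rdvd G). Proof. by have [[]] := garsideG. Qed.

Let subP (x : M) : H (val x). Proof. by rewrite -inE; apply: valP. Qed.
Lemma submonoid_lift (x : G) : H x -> exists y : M, val y = x.
Proof. by move/mem_set => Hx; exists (Sub x Hx); rewrite SubK. Qed.

Let range_val : range (val : M -> G) = H.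
Proof.
apply/seteqP; split=> [_ [x _ <-]|x /submonoid_lift[y <-]]; first exact: subP.
by exists y.
Qed.

Let val_prod (s : seq M) : val (\prod_(x <- s) x) = \prod_(x <- s) val x.
Proof. exact: (big_morph _ (@valM _ _ M) (@val1 _ _ M)). Qed.

Lemma ldvd_in_val (x y : M) : ldvd x y <-> ldvd_in H (val x) (val y).
Proof.
split=> [[k ->]|[_ /submonoid_lift[k <-] yE]].
  by exists (val k) => //; rewrite valM.
by exists k; apply: val_inj; rewrite valM.
Qed.

Lemma rdvd_in_val (x y : M) : rdvd x y <-> rdvd_in H (val x) (val y).
Proof.
split=> [[k ->]|[_ /submonoid_lift[k <-] yE]].
  by exists (val k) => //; rewrite valM.
by exists k; apply: val_inj; rewrite valM.
Qed.

Lemma ldvd_val (x y : M) : ldvd x y <-> ldvd (val x) (val y).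
Proof.
by rewrite ldvd_in_val; have [_ _ _ ->] := garside_submonoid_ldvd subH.
Qed.

Lemma rdvd_val (x y : M) : rdvd x y <-> rdvd (val x) (val y).
Proof.
by rewrite rdvd_in_val; have [_ _ _ ->] := garside_submonoid_rdvd subH.
Qed.

Lemma submonoid_ldvd_lattice : is_lattice (@ldvd M).
Proof.
exact: (sublattice_is_lattice latL (garside_submonoid_ldvd subH)
  val_inj range_val ldvd_in_val).
Qed.

Lemma submonoid_rdvd_lattice : is_lattice (@rdvd M).
Proof.
exact: (sublattice_is_lattice latR (garside_submonoid_rdvd subH)
  val_inj range_val rdvd_in_val).
Qed.

Lemma submonoid_noetherian : noetherian M.
Proof.
move=> g; apply: sub_finite_set (noeG (val g)) => n /= [s [sn s1 ->]].
exists (map val s); split; rewrite ?size_map ?val_prod ?big_map//.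
by move=> _ /mapP[x xs ->] x1; apply: (s1 x xs); apply: val_inj; rewrite val1.
Qed.

Lemma submonoid_cancellative : cancellative M.
Proof.
move=> g h h' k /(congr1 val); rewrite !valM => E.
by apply: val_inj; apply: canG E.
Qed.

Lemma generates_ldivisors : generates (ldivisors D).
Proof. by have [_ <-] := garsideD; have [[]] := garsideG. Qed.

(** The head of the normal form of an element of [H] is in [H], and so is its
cofactor; iterating, the whole normal form is in [H]. *)
Lemma submonoid_generates : generates XH.
Proof.
apply/seteqP; split=> // w _ P [[P1 PM] XP].
rewrite inE in P1.
have [l l_len] := noetherian_length noeG.
have [n] := ubnP (l (val w)); elim: n => // n IHn in w *.
rewrite ltnS => lwn; have [->//|w1] := pselect (w = 1).
have vw1 : val w <> 1 by rewrite -(val1 M) => /val_inj.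
have aw1 := alphaL_neq1 latL generates_ldivisors vw1.
have [aw aD _] := alphaLP D latL (val w).
have [|a aE] := @submonoid_lift (alphaL D (val w)).
  by apply: (garside_submonoid_alphaL subH); exists (val w).
rewrite -aE in aw aw1 aD; have [k wE] := (ldvd_val a w).2 aw.
rewrite wE in lwn *; rewrite -inE; apply: PM; rewrite inE; first exact: XP.
by apply: IHn; apply: leq_trans lwn; rewrite valM; apply: length_ltM.
Qed.

(** Let d and d' be the greatest elements of [H `&` ldivisors D] for left and
for right divisibility. Then d' left-divides d and d right-divides d', so that
d = k' * d * k in [G], and comparing lengths gives k = 1, that is d = d'. *)
Lemma submonoid_garside_element : exists d : M,
  [/\ forall x : M, ldvd x d <-> ldvd (val x) D,
      forall x : M, rdvd x d <-> ldvd (val x) D & ldvd (val d) D].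
Proof.
have [balD defX] := garsideD.
have finD : finite_set (H `&` ldivisors D).
  by apply: finite_setIr; rewrite -defX; have [] := garsideG.
have neD : H `&` ldivisors D !=set0.
  exists 1; split; last by exists D; rewrite mul1g.
  by rewrite -inE; have [] := garside_submonoid_closed subH.
have balE x : ldvd x D <-> rdvd x D.
  by rewrite -[ldvd x D]/(ldivisors D x) balD.
have [|_ [/submonoid_lift[d <-] dD] dmax] :=
    finite_directed_max (let: And5 r _ _ _ _ := latL in r)
      (let: And5 _ _ t _ _ := latL in t) finD neD.
  move=> x y [Hx xD] [Hy yD]; exists (join (@ldvd G) 1 x y).
  have [xj yj jmin] := joinP latL 1 x y; split=> //; split; last exact: jmin.
  by have [_ _ joinH _] := garside_submonoid_ldvd subH; apply: joinH.
have [|_ [/submonoid_lift[d' <-] d'D] d'max] :=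
    finite_directed_max (let: And5 r _ _ _ _ := latR in r)
      (let: And5 _ _ t _ _ := latR in t) finD neD.
  move=> x y [Hx /balE xD] [Hy /balE yD]; exists (join (@rdvd G) 1 x y).
  have [xj yj jmin] := joinP latR 1 x y; split=> //; split.
    by have [_ _ joinH _] := garside_submonoid_rdvd subH; apply: joinH.
  exact/balE/jmin.
have dd' : d = d'.
  have [l [l_mul l0]] := noetherian_length noeG.
  have [k dE] : ldvd (val d') (val d) by apply: dmax.
  have [k' d'E] : rdvd (val d) (val d') by apply: d'max.
  suff k1 : k = 1 by apply: val_inj; rewrite dE k1 mulg1.
  apply: l0; have := leq_trans (leq_add (l_mul k' (val d)) (leqnn (l k)))
    (l_mul _ k).
  rewrite -d'E -dE addnAC -[X in (_ <= X)%N]add0n leq_add2r leqn0 addn_eq0.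
  by case/andP=> _ /eqP.
subst d'; have [_ _ transL _ _] := latL; have [_ _ transR _ _] := latR.
exists d; split=> // x; split.
- by move/ldvd_val => xd; apply: transL dD.
- by move=> xD; apply/ldvd_val/dmax; split.
- by move/rdvd_val => xd; apply/balE; apply: transR xd _; apply/balE.
- by move=> xD; apply/rdvd_val/d'max; split.
Qed.

Lemma submonoid_garside_monoid : garside_monoid XH.
Proof.
split; last first.
  apply: (@finite_preimage _ _ (ldivisors D) (val : M -> G)).
    by move=> x y _ _; apply: val_inj.
  by have [_ <-] := garsideD; have [] := garsideG.
split.
- by split; [exact: submonoid_noetherian | exact: submonoid_cancellative].
- exact: submonoid_ldvd_lattice.
- exact: submonoid_rdvd_lattice.
- exact: submonoid_generates.
- have [d [dL dR _]] := submonoid_garside_element; exists d.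
  by split; apply/seteqP; split=> x; rewrite /ldivisors /rdivisors /= ?dL ?dR.
Qed.

(** [alphaL D (val x)] lies in [H] and divides [D], hence divides [d]; so it is
also the gcd of x and d taken in the submonoid. *)
Lemma val_alphaL (d x : M) :
  garside_element XH d -> val (alphaL d x) = alphaL D (val x).
Proof.
move=> [_ XHE]; have dE (y : M) : ldvd y d <-> ldvd (val y) D.
  by rewrite -[ldvd y d]/(ldivisors d y) -XHE.
have [ax aD amax] := alphaLP D latL (val x).
have [|a aE] := @submonoid_lift (alphaL D (val x)).
  by apply: (garside_submonoid_alphaL subH); exists (val x).
rewrite -aE in ax aD amax *; congr val.
apply: (glb_unique submonoid_ldvd_lattice (alphaLP d submonoid_ldvd_lattice x)).
split; [exact/ldvd_val | exact/dE |].
by move=> z /ldvd_val zx /dE zD; apply/ldvd_val/amax.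
Qed.

Lemma normal_form_val (d w : M) s : garside_element XH d ->
  normal_form d w s -> normal_form D (val w) (map val s).
Proof.
move=> dP [-> s1 aE]; split.
- by rewrite val_prod big_map.
- by rewrite -(val1 M) last_map => /val_inj.
- move=> i; rewrite size_map => i_s; rewrite -map_drop big_map -val_prod.
  by rewrite -(val_alphaL _ dP) aE// -(val1 M) (nth_map 1).
Qed.

End GarsideSubmonoid.

(** The cofactor in a divisibility is unique, so it lies in both submonoids as
soon as it lies in each of them; the remaining conditions are closure
properties, stable under intersection. *)
Lemma garside_submonoidI (G : monoidType) (D : G) (H K : set G) :
    cancellative G -> garside_submonoid D H -> garside_submonoid D K ->
  garside_submonoid D (H `&` K).
Proof.
move=> canG [[H1 HM] [_ HmL HjL HL] [_ HmR HjR HR] HaL HaR].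
move=> [[K1 KM] [_ KmL KjL KL] [_ KmR KjR KR] KaL KaR].
rewrite !inE in H1 K1.
have ne0 : H `&` K !=set0 by exists 1.
split.
- split=> [|x y]; rewrite ?inE// => -[Hx Kx] [Hy Ky]; split; rewrite -inE.
    by apply: HM; rewrite inE.
  by apply: KM; rewrite inE.
- split=> // x y [Hx Kx] [Hy Ky].
  + by split; [apply: HmL | apply: KmL].
  + by split; [apply: HjL | apply: KjL].
  split=> [[k _ ->]|xy]; first by exists k.
  have [k Hk yE] := (HL _ _ Hx Hy).2 xy; exists k => //; split=> //.
  have [k' Kk' yE'] := (KL _ _ Kx Ky).2 xy.
  by rewrite (cancellative_mulgI canG (etrans (esym yE) yE')).
- split=> // x y [Hx Kx] [Hy Ky].
  + by split; [apply: HmR | apply: KmR].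
  + by split; [apply: HjR | apply: KjR].
  split=> [[k _ ->]|xy]; first by exists k.
  have [k Hk yE] := (HR _ _ Hx Hy).2 xy; exists k => //; split=> //.
  have [k' Kk' yE'] := (KR _ _ Kx Ky).2 xy.
  by rewrite (cancellative_mulIg canG (etrans (esym yE) yE')).
- move=> _ [x [Hx Kx] <-].
  by split; [apply: HaL | apply: KaL]; exists x.
- move=> _ [x [Hx Kx] <-].
  by split; [apply: HaR | apply: KaR]; exists x.
Qed.

Theorem proposition1 (G : monoidType) (X : set G) (D : G)
    (garsideG : garside_monoid X) (garsideD : garside_element X D) :
  [/\ (* (a) *)
      forall (H : set G) (subH : garside_submonoid D H),
        let M := submonoid_type (garside_submonoid_closed subH) in
        let XH : set M := [set x | ldivisors D (val x)] in
        garside_monoid XH /\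
        exists d : M,
          [/\ garside_element XH d,
              is_sup (@ldvd G) (H `&` ldivisors D) (val d) &
              is_sup (@rdvd G) (H `&` ldivisors D) (val d)],
      (* (b) *)
      forall (H : set G) (subH : garside_submonoid D H),
        let M := submonoid_type (garside_submonoid_closed subH) in
        let XH : set M := [set x | ldivisors D (val x)] in
        forall (d w : M), garside_element XH d -> w <> 1 ->
        exists s : seq M,
          unique (normal_form d w) s /\
          unique (normal_form D (val w)) (map val s) &
      (* (c) *)
      forall H K : set G,
        garside_submonoid D H -> garside_submonoid D K ->
        garside_submonoid D (H `&` K)].
Proof.
have [[[_ canG] latL _ _ _] _] := garsideG.
split=> [H subH M XH|H subH M XH d w dP w1|H K].
- split; first exact (submonoid_garside_monoid garsideG garsideD subH).
  have [d [dL dR dD]] := submonoid_garside_element garsideG garsideD subH.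
  have subK := submonoid_lift subH.
  have Hd : H (val d) by rewrite -inE; apply: valP.
  exists d; split.
  + by split; apply/seteqP; split=> x; rewrite /ldivisors /rdivisors /= ?dL ?dR.
  + split=> [_ [/subK[x <-] xD]|z]; last by apply; split.
    exact/ldvd_val/dL.
  + split=> [_ [/subK[x <-] xD]|z]; last by apply; split.
    exact/rdvd_val/dR.
- have [[[noeM canM] latM _ genM _] _] :=
    submonoid_garside_monoid garsideG garsideD subH.
  have [s nf_s] : exists s, normal_form d w s.
    by apply: normal_form_exists => //; have [_ <-] := dP.
  have nf_vs := normal_form_val garsideG dP nf_s.
  exists s; split; split=> // t; exact: normal_form_inj.
- exact: garside_submonoidI.
Qed.
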